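(* Suppose $f$ is ramified in $D$, so that $\mathfrak{F}=fD=P^2$ for a prime ideal $P$ of $D$. There exists a basic element $t\in O$ such that $P^5\subsetneq tO\subsetneq P^3$ if and only if $P$ is a principal ideal of $D$. If this condition holds, say $P=\beta D$, for some $\beta\in D$, then every basic element is associated to $f\beta$ by a unit of $D$ (i.e. is of the form $f\beta w$ for some $w\in D^*$).
   Context: Let $d$ be a square-free integer ($d\neq 1$), $K=\mathbb{Q}(\sqrt d)$ and $D=\mathbb{Z}[\omega]$ its ring of integers, where $\omega=\sqrt d$ if $d\equiv 2,3 \pmod 4$ and $\omega=(1+\sqrt d)/2$ if $d\equiv 1\pmod 4$. Let $f$ be a prime number and $O=\mathbb{Z}[f\omega]$, the unique order of $K$ with $[D:O]=f$. The conductor of $O$ is $\mathfrak{F}=\{x\in O: xD\subseteq O\}=fD$; it is a prime ideal of $O$. $D^*$ is the unit group of $D$. An ideal of $O$ is $\mathfrak{F}$-primary if it is primary with radical $\mathfrak{F}$; an $\mathfrak{F}$-primary ideal is basic if it is not contained in $\mathfrak{F}^2$. An element $t\in O$ is basic if $tO$ is a basic $\mathfrak{F}$-primary ideal.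
   Formalization: The last claim is stated only for basic elements t with P^5 ⊊ tO ⊊ P^3, not for every basic element: t = f is basic, yet f = fβw would make β a unit of D. *)

(* Defs.v *)
From mathcomp Require Import all_boot all_order all_algebra all_field.
From mathcomp Require Import boolp classical_sets.

Set Implicit Arguments.
Unset Strict Implicit.
Unset Printing Implicit Defensive.

Import GRing.Theory Num.Theory.

Local Open Scope classical_set_scope.
Local Open Scope ring_scope.

(* Rings are subrings [R] of an ambient commutative ring [A], given as sets,
   and ideals of [R] are subsets of [A] too: ideals of an order and of the
   maximal order containing it can then be compared by plain inclusion. *)
Section Ideals.
Variable A : comNzRingType.
Implicit Types (R S I J F P : set A) (x : A).

(* Z[x] *)
Definition Zadjoin x : set A :=
  range (fun p : {poly int} => (map_poly intr p).[x]).

Definition ideal R I : Prop :=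
  [/\ I `<=` R, I 0, forall u v, I u -> I v -> I (u + v)
    & forall r u, R r -> I u -> I (r * u)].

Definition prime_ideal R P : Prop :=
  [/\ ideal R P, ~ P 1
    & forall u v, R u -> R v -> P (u * v) -> P u \/ P v].

Definition radical R I : set A := [set x | R x /\ exists n : nat, I (x ^+ n)].

Definition primary_ideal R I : Prop :=
  [/\ ideal R I, ~ I 1
    & forall u v, R u -> R v -> I (u * v) -> I u \/ exists n : nat, I (v ^+ n)].

Definition principal R x : set A := [set x * y | y in R].

Definition is_principal R I : Prop := exists2 x, R x & I = principal R x.

(* finite sums of products of an element of I by an element of J *)
Definition idealM I J : set A :=
  [set x | exists2 s : seq (A * A),
     (forall p, p \in s -> I p.1 /\ J p.2) & x = \sum_(p <- s) p.1 * p.2].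

Definition idealX R I (n : nat) : set A := iter n (idealM I) R.

Definition units R : set A := [set u | R u /\ exists2 v, R v & u * v = 1].

Definition conductor R S : set A :=
  [set x | R x /\ forall y, S y -> R (x * y)].

Definition primary_to R F I : Prop := primary_ideal R I /\ radical R I = F.

Definition basic_ideal R F I : Prop :=
  primary_to R F I /\ ~ (I `<=` idealX R F 2).

Definition basic_element R F x : Prop := R x /\ basic_ideal R F (principal R x).

End Ideals.

Definition square_free (d : int) : Prop :=
  forall m : int, (m ^+ 2 %| d)%Z -> m \is a GRing.unit.

Definition omega (d : int) : algC :=
  if (d %% 4)%Z == 1 then (1 + sqrtC d%:~R) / 2 else sqrtC d%:~R.

Definition max_order (d : int) : set algC := Zadjoin (omega d).

Definition order_of_index (d : int) (f : nat) : set algC :=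
  Zadjoin (f%:R * omega d).

(* Main.v *)
Require Import Defs.
From mathcomp Require Import all_boot all_order all_algebra all_field.
From mathcomp Require Import boolp classical_sets.
From mathcomp Require Import ring.

Set Implicit Arguments.
Unset Strict Implicit.
Unset Printing Implicit Defensive.

Import GRing.Theory Num.Theory.

Local Open Scope classical_set_scope.
Local Open Scope ring_scope.

(** Everything rests on two identities: P P = f D, which makes every power of P
    a multiple of D or of P, so that P^3 = f P and P^5 = f^2 P, and F = f D,
    which gives F^2 = f^2 D for the square formed in O ([conductorE]).

    If t is basic and P^5 < t O < P^3 = f P, write t = f s with s in P. Since
    t O is not inside F^2 = f^2 D, s is not in f D = P^2, while f^2 P <= f s O
    gives f P <= s D. So s D lies between P^3 and P without lying in P^2, and
    by unique factorization of ideals this forces s D = P; in the case at hand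
    [square_root_principal] derives it directly from P^2 = f D and the
    maximality of P. This both shows that P is principal and determines t up to
    a unit of D, two generators of P being associated.

    Conversely, if P = beta D, then t = f beta works. The inclusions come from
    f D <= O <= D, and they are strict because f beta is not in f^2 P, while
    f beta omega is in f P but not in f beta O. The ideal t O is F-primary because
    F is a maximal ideal of O ([conductor_maximal]) whose elements all have
    their cube in t O, and it is basic because beta is not in P^2 = f D.

    The maximality of P and of F comes from the quadratic equation of omega: an
    integer outside an ideal containing f is invertible modulo that ideal, by
    Bezout, and modulo P or F an inverse can be found through integers. *)

(** * Subrings, products of ideals, maximal ideals *)

Section IdealProducts.
Variable A : comNzRingType.
Implicit Types (R I J K M : set A) (x y c : A).

Definition subring R : Prop :=
  [/\ R 1, R (- 1), forall u v, R u -> R v -> R (u + v)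
    & forall u v, R u -> R v -> R (u * v)].

Lemma subring0 R : subring R -> R 0.
Proof. by case=> R1 RN1 RD _; rewrite -(subrr 1); apply: RD. Qed.

Lemma subringN R u : subring R -> R u -> R (- u).
Proof. by case=> _ RN1 _ RM Ru; rewrite -mulN1r; apply: RM. Qed.

Lemma subringB R u v : subring R -> R u -> R v -> R (u - v).
Proof. by move=> sR Ru Rv; case: (sR) => _ _ RD _; apply: RD => //; apply: subringN. Qed.

Lemma idealB R I u v : subring R -> ideal R I -> I u -> I v -> I (u - v).
Proof.
move=> [_ RN1 _ _] [_ _ ID IM] Iu Iv.
by apply: ID => //; rewrite -mulN1r; apply: IM.
Qed.

Lemma idealMr R I u r : ideal R I -> I u -> R r -> I (u * r).
Proof. by move=> [_ _ _ IM] Iu Rr; rewrite mulrC; apply: IM. Qed.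

Lemma principal_ideal R x : subring R -> R x -> ideal R (principal R x).
Proof.
move=> sR Rx; case: (sR) => _ _ RD RM; split.
- by move=> _ [y Ry <-]; apply: RM.
- by exists 0; [apply: subring0 | rewrite mulr0].
- by move=> _ _ [y Ry <-] [z Rz <-]; exists (y + z); rewrite ?mulrDr //; apply: RD.
- by move=> r _ Rr [y Ry <-]; exists (r * y); [apply: RM | rewrite mulrCA].
Qed.

Lemma idealM_mem I J x y : I x -> J y -> idealM I J (x * y).
Proof.
move=> Ix Jy; exists [:: (x, y)]; last by rewrite big_seq1.
by move=> p; rewrite inE => /eqP ->.
Qed.

(** The universal property of I J: it is the least additive set containing
    the products, so inclusions need only be tested on single products. *)
Lemma idealM_sub I J K : K 0 -> (forall u v, K u -> K v -> K (u + v)) ->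
  (forall x y, I x -> J y -> K (x * y)) -> idealM I J `<=` K.
Proof.
move=> K0 KD KM _ [s IJs ->]; rewrite big_seq.
by apply: (big_ind K) => // p /IJs[Ip Jp]; apply: KM.
Qed.

Lemma idealM1 R I : subring R -> ideal R I -> idealM I R = I.
Proof.
move=> [R1 _ _ _] idI; case: (idI) => _ I0 ID _; apply/seteqP; split.
  by apply: idealM_sub => // x y Ix Ry; apply: (@idealMr R).
by move=> x Ix; rewrite -[x]mulr1; apply: idealM_mem.
Qed.

(** Here [principal J c] is the dilate c J of an ideal J: together with
    [idealM1] this is what turns P P = f D into formulas for all P^n. *)
Lemma idealM_scale I J c :
  idealM I (principal J c) = principal (idealM I J) c.
Proof.
apply/seteqP; split=> [_ [s IJs ->]|_ [_ [s IJs ->] <-]].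
  rewrite big_seq; apply: (big_ind (principal (idealM I J) c)).
  - exists 0; last by rewrite mulr0.
    by exists [::]; rewrite ?big_nil.
  - move=> _ _ [_ [s1 IJ1 ->] <-] [_ [s2 IJ2 ->] <-]; rewrite -mulrDr.
    rewrite -big_cat; exists (\sum_(p <- s1 ++ s2) p.1 * p.2) => //.
    by exists (s1 ++ s2) => // p; rewrite mem_cat => /orP[/IJ1|/IJ2].
  - move=> p /IJs[Ip [y Jy <-]]; exists (p.1 * y); last by rewrite mulrCA.
    exact: idealM_mem.
exists [seq (p.1, c * p.2) | p <- s].
  by move=> _ /mapP[p /IJs[Ip Jp] ->]; split=> //; exists p.2.
by rewrite big_map mulr_sumr; apply: eq_bigr => p _; rewrite mulrCA.
Qed.

(** Maximality is encoded as the quotient being a field, that is, as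
    invertibility modulo M: the form in which it gets used. *)
Definition maximal_ideal R M : Prop :=
  [/\ ideal R M, ~ M 1
    & forall v, R v -> ~ M v -> exists2 w, R w & M (1 - v * w)].

(** Inverses modulo M lift to inverses modulo any I that contains n-th powers
    of the elements of M: (1 - v w)^n is again of the form 1 - v z. *)
Lemma maximal_inv_mod R M I v : subring R -> maximal_ideal R M ->
  (exists n, forall x, M x -> I (x ^+ n)) ->
  R v -> ~ M v -> exists2 w, R w & I (1 - v * w).
Proof.
move=> sR [_ _ invM] [n MI] Rv Mv; have [w Rw Mvw] := invM v Rv Mv.
have [R1 _ RD RM] := sR.
have [z Rz ez] : exists2 z, R z & (1 - v * w) ^+ n = 1 - v * z.
  elim: n {MI} => [|n [z Rz ez]].
    by exists 0; [apply: subring0 | rewrite expr0 mulr0 subr0].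
  (* read off from (1 - v w) (1 - v z) = 1 - v z' *)
  exists (z + w * (1 - v * z)); last by rewrite exprS ez; ring.
  by apply: (RD) => //; apply: (RM) => //; apply: subringB => //; apply: RM.
by exists z => //; rewrite -ez; apply: MI.
Qed.

(** An ideal whose radical is maximal is primary: an element outside M is
    invertible modulo I, hence can be cancelled modulo I. *)
Lemma primary_to_maximal R M I : subring R -> maximal_ideal R M ->
  ideal R I -> I `<=` M -> (exists n, forall x, M x -> I (x ^+ n)) ->
  primary_to R M I.
Proof.
move=> sR maxM idI IM MI; have [idM M1 invM] := maxM.
have [_ _ ID _] := idI; have [MR _ MD MM] := idM; have [R1 _ _ RM] := sR.
split; first split=> //.
- by move/IM.
- move=> u v Ru Rv Iuv; have [Mv|nMv] := pselect (M v).
    by right; have [n MIn] := MI; exists n; apply: MIn.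
  left; have [w Rw Ivw] := maximal_inv_mod sR maxM MI Rv nMv.
  have -> : u = u * v * w + (1 - v * w) * u by ring.
  by apply: ID; apply: (@idealMr R).
apply/seteqP; split=> [v [Rv [n /IM]]|x Mx].
  elim: n => [|n IHn]; first by rewrite expr0.
  have [//|nMv] := pselect (M v); have [w Rw Mvw] := invM v Rv nMv.
  have Rvn : R (v ^+ n).
    by elim: n {IHn} => [|n IHn]; rewrite ?expr0 // exprS; apply: RM.
  move=> Mvn; apply: IHn.
  have -> : v ^+ n = v ^+ n.+1 * w + (1 - v * w) * v ^+ n
    by rewrite exprS; ring.
  by apply: MD; apply: (@idealMr R).
by split; [apply: MR | have [n MIn] := MI; exists n; apply: MIn].
Qed.

End IdealProducts.

(** * A prime whose square is principal *)

Section Domain.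
Variable A : idomainType.

Lemma principal_eq_associate (R : set A) (x y : A) : subring R -> x != 0 ->
  principal R x = principal R y -> exists2 w, units R w & y = x * w.
Proof.
move=> [R1 _ _ _] x0 exy.
have [w Rw ew] : principal R x y by rewrite exy; exists 1; rewrite ?mulr1.
have [v Rv ev] : principal R y x by rewrite -exy; exists 1; rewrite ?mulr1.
exists w => //; split=> //; exists v => //.
by apply: (mulfI x0); rewrite mulr1 mulrA ew.
Qed.

End Domain.

Section SquareRoot.
Variables (A : idomainType) (D P : set A) (f : A).
Hypotheses (subD : subring D) (idP : ideal D P).
Hypothesis PP : idealM P P = principal D f.

Lemma idealX3 : idealX D P 3 = principal P f.
Proof. by rewrite /idealX /= (idealM1 subD idP) PP idealM_scale (idealM1 subD idP). Qed.

Lemma idealX5 : idealX D P 5 = principal (principal P f) f.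
Proof.
by rewrite /idealX 2!iterS -[iter 3 _ _]/(idealX D P 3) idealX3 !idealM_scale PP
   idealM_scale (idealM1 subD idP).
Qed.

Lemma square_root_mem : P f.
Proof.
have [PD P0 PA PM] := idP; have [D1 _ _ _] := subD.
have : idealM P P f by rewrite PP; exists 1; rewrite ?mulr1.
by apply: idealM_sub => // x y Px Py; apply: PM => //; apply: PD.
Qed.

(** Otherwise b would be in P P = b P, making 1 an element of P. *)
Lemma square_root_generator_notin b : ~ P 1 -> b != 0 ->
  P = principal D b -> ~ principal D f b.
Proof.
have [PD P0 PA PM] := idP; move=> nP1 b0 eP; rewrite -PP => PPb.
suff /(_ b PPb)[p Pp ep] : idealM P P `<=` principal P b.
  by apply: nP1; rewrite -(mulfI b0 (etrans ep (esym (mulr1 b)))).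
apply: idealM_sub => [|_ _ [u Pu <-] [v Pv <-]|p q].
- by exists 0; rewrite ?mulr0.
- by exists (u + v); [apply: PA | rewrite mulrDr].
- rewrite {1}eP => -[y Dy <-] Pq.
  by exists (y * q); [apply: PM | rewrite mulrA].
Qed.

Hypotheses (maxP : maximal_ideal D P) (f_neq0 : f != 0).

(** The ideal J = s P / f of D is integral, as s P <= P P = f D, and contains
    P P, so it is D or lies in P. If J = D, then s P = P P, whence s D = P.
    If J <= P, then s P <= f P; multiplying by P gives s f in f (f D), so that
    s is in f D. The two cases below are whether J meets D \ P. *)
Lemma square_root_principal s : P s -> ~ principal D f s ->
  principal P f `<=` principal D s -> P = principal D s.
Proof.
have [_ P1 invP] := maxP; have [PD _ PA PM] := idP; have [D1 _ DD DM] := subD.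
move=> Ps nfDs fPs; apply/seteqP; split; last first.
  by move=> _ [y Dy <-]; apply: (@idealMr _ D).
have mulPP p q : P p -> P q -> exists2 y, D y & f * y = p * q.
  by move=> Pp Pq; have := idealM_mem Pp Pq; rewrite PP => -[y ? <-]; exists y.
have [[p0 [j [Pp0 Dj nPj ej]]]|sP] :=
    pselect (exists p j, [/\ P p, D j, ~ P j & f * j = s * p]).
  have PPfD : exists n, forall x, P x -> principal D f (x ^+ n).
    by exists 2%N => x Px; have [y Dy ey] := mulPP x x Px Px; exists y.
  (* j generates D modulo f D = P P: it has an inverse w there *)
  have [w Dw [y Dy ey]] := maximal_inv_mod subD maxP PPfD Dj nPj.
  move=> p Pp; have [v Dv ev] := mulPP p0 p Pp0 Pp.
  have [u Du eu] : principal D s (f * (p * y)).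
    by apply: fPs; exists (p * y) => //; apply: (@idealMr _ D).
  exists (v * w + u); first by apply: (DD) => //; apply: DM.
  apply: (mulfI f_neq0).
  have -> : f * p = f * j * p * w + f * (f * y) * p by rewrite ey; ring.
  rewrite ej mulrDr mulrDr eu.
  have -> : f * (s * (v * w)) = s * (f * v) * w by ring.
  by rewrite ev; ring.
(* now J <= P *)
case: nfDs; have Pf := square_root_mem; have fPP : idealM P P f by rewrite PP; exists 1; rewrite ?mulr1.
have sfP p : P p -> exists2 q, P q & s * p = f * q.
  move=> Pp; have [j Dj ej] := mulPP s p Ps Pp; exists j => //.
  by have [//|nPj] := pselect (P j); case: sP; exists p, j.
have [_ fD0 fDD _] := principal_ideal subD (PD f Pf).
have sub : idealM P P `<=` [set x | principal (principal D f) f (s * x)].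
  apply: idealM_sub => [|u v [x fDx ex] [y fDy ey]|p q Pp Pq] /=.
  - by exists 0; rewrite ?mulr0.
  - by exists (x + y); [apply: fDD | rewrite !mulrDr ex ey].
  - have [p' Pp' ep'] := sfP p Pp; have [y Dy ey] := mulPP p' q Pp' Pq.
    by exists (f * y); [exists y | rewrite ey mulrA -ep' -mulrA].
have [_ [y Dy <-] ey] := sub f fPP.
by exists y => //; apply: (mulfI f_neq0); rewrite ey mulrC.
Qed.

End SquareRoot.

(** * Quadratic rings Z[x] *)

Section QuadraticRing.
Variables (A : comNzRingType) (x : A) (T N : int).
Hypothesis x2 : x ^+ 2 = T%:~R * x + N%:~R.

Lemma subring_Zadjoin (y : A) : subring (Zadjoin y).
Proof.
split.
- by exists 1; rewrite // rmorph1 hornerC.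
- by exists (- 1); rewrite // rmorphN1 hornerN hornerC.
- by move=> _ _ [p _ <-] [q _ <-]; exists (p + q); rewrite // rmorphD hornerD.
- by move=> _ _ [p _ <-] [q _ <-]; exists (p * q); rewrite // rmorphM hornerM.
Qed.

Lemma Zadjoin_int (y : A) (a : int) : Zadjoin y a%:~R.
Proof. by exists a%:P; rewrite // map_polyC hornerC. Qed.

Lemma Zadjoin_gen (y : A) : Zadjoin y y.
Proof. by exists 'X; rewrite // map_polyX hornerX. Qed.

Lemma Zadjoin_quadraticP (y : A) :
  Zadjoin x y <-> exists a b : int, y = a%:~R + b%:~R * x.
Proof.
have [_ _ ZD ZM] := subring_Zadjoin x; split=> [[p _ <-]|[a [b ->]]]; last first.
  apply: ZD; first exact: Zadjoin_int.
  by apply: ZM; [apply: Zadjoin_int | apply: Zadjoin_gen].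
elim/poly_ind: p => [|p c [a [b ep]]].
  by exists 0, 0; rewrite rmorph0 horner0 mul0r addr0.
rewrite rmorphD rmorphM /= map_polyX map_polyC hornerMXaddC ep.
exists (b * N + c), (a + b * T).
transitivity (a%:~R * x + b%:~R * x ^+ 2 + c%:~R); first by ring.
by rewrite x2 !rmorphD !rmorphM /=; ring.
Qed.

Variables (p : nat) (p_pr : prime p).

(** Bezout, since a is prime to p as soon as it is not in I. *)
Lemma ideal_int_inv (R I : set A) : subring R -> (forall a : int, R a%:~R) ->
  ideal R I -> I p%:R -> forall a : int, ~ I a%:~R ->
  exists u : int, I (1 - a%:~R * u%:~R).
Proof.
move=> sR Rint idI Ip a nIa; have [|] := boolP (p %| a)%Z.
  move=> /dvdzP[q ea]; case: nIa; rewrite ea rmorphM /= mulrC.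
  exact: idealMr idI Ip (Rint q).
move=> npa; have /coprimezP[[u v] /= euv] : coprimez a p.
  by rewrite coprimez_sym coprimezE /= prime_coprime.
have e1 : u%:~R * a%:~R + v%:~R * p%:R = 1 :> A.
  by rewrite [p%:R]pmulrn -!rmorphM -rmorphD euv.
exists u; have -> : 1 - a%:~R * u%:~R = p%:R * v%:~R :> A.
  by apply: (canLR (addrK _)); rewrite -[LHS]e1; ring.
exact: idealMr idI Ip (Rint v).
Qed.

(** An element v = a + b x satisfies v (v - t) = c with integers t (its trace)
    and c (minus its norm). Outside P, it is inverted modulo P through c if c
    is not in P; otherwise v - t is in P, so v is congruent to the integer t. *)
Lemma quadratic_maximal (P : set A) : prime_ideal (Zadjoin x) P -> P p%:R ->
  maximal_ideal (Zadjoin x) P.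
Proof.
have sR := subring_Zadjoin x; have [R1 _ RD RM] := sR.
move=> [idP nP1 primeP] Pp; have [_ _ PD PM] := idP; split=> // v Rv nPv.
have invP := ideal_int_inv sR (Zadjoin_int x) idP Pp.
have [a [b ev]] := (Zadjoin_quadraticP v).1 Rv.
pose t : int := a + a + b * T; pose c : int := b ^+ 2 * N - a ^+ 2 - a * b * T.
have evc : v * (v - t%:~R) = c%:~R.
  transitivity (b%:~R ^+ 2 * x ^+ 2 - a%:~R ^+ 2 - a%:~R * b%:~R * T%:~R
     - b%:~R ^+ 2 * T%:~R * x); rewrite /c /t.
    by rewrite ev !rmorphD !rmorphM /=; ring.
  by rewrite x2 !rmorphB !rmorphM /=; ring.
have Rvt : Zadjoin x (v - t%:~R) by apply: subringB => //; apply: Zadjoin_int.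
have [Pc|nPc] := pselect (P c%:~R).
  have Pvt : P (v - t%:~R).
    by move: Pc; rewrite -evc => /primeP[].
  have [|u Ptu] := invP t.
    by move=> Pt; apply: nPv; rewrite -(subrK t%:~R v); apply: PD.
  exists u%:~R; first exact: Zadjoin_int.
  have -> : 1 - v * u%:~R = 1 - t%:~R * u%:~R - (v - t%:~R) * u%:~R by ring.
  by apply: (idealB sR idP) => //; apply: (idealMr idP) => //; apply: Zadjoin_int.
have [u Pcu] := invP c nPc.
exists ((v - t%:~R) * u%:~R); first by apply: RM => //; apply: Zadjoin_int.
by rewrite mulrA evc.
Qed.

End QuadraticRing.

(** * The order Z[f x] and its conductor *)

Section Order.
Variables (x : algC) (T N : int).
Hypothesis x2 : x ^+ 2 = T%:~R * x + N%:~R.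
Hypothesis x_free : forall a b : int, a%:~R + b%:~R * x = 0 -> a = 0 /\ b = 0.
Variables (f : nat) (f_pr : prime f).

Let D := Zadjoin x.
Let O := Zadjoin (f%:R * x).
Let F := conductor O D.

Lemma coord_inj (a b a' b' : int) :
  a%:~R + b%:~R * x = a'%:~R + b'%:~R * x -> a = a' /\ b = b'.
Proof.
move=> e; have [|ea eb] := @x_free (a - a') (b - b').
  rewrite !rmorphB /= mulrBl addrACA e -opprD; exact: subrr.
by split; apply/subr0_eq.
Qed.

Lemma orderP y : O y <-> exists a b : int, y = a%:~R + b%:~R * (f%:R * x).
Proof.
apply: (@Zadjoin_quadraticP _ _ (f%:Z * T) (f%:Z ^+ 2 * N)).
by rewrite exprMn x2 !rmorphM /= -!pmulrn; ring.
Qed.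

Lemma order_sub : O `<=` D.
Proof.
move=> _ /orderP[a [b ->]]; apply/(Zadjoin_quadraticP x2).
by exists a, (b * f%:Z); rewrite rmorphM /= -pmulrn mulrA.
Qed.

Lemma generator_notin_order : ~ O x.
Proof.
move=> /orderP[a [b e]]; have [|_ eb] := @coord_inj 0 1 a (b * f%:Z).
  by rewrite mul1r add0r {1}e rmorphM /= -pmulrn mulrA.
have : (f%:Z %| 1%R)%Z by rewrite eb dvdz_mull.
by rewrite dvdz1 /=; case: (f) f_pr => [|[]].
Qed.

(** An element a + b f x of O lies in F only if its product by x is in O; there
    the coefficient of x is a modulo f, so f divides a. *)
Lemma conductorE : F = principal D f%:R.
Proof.
apply/seteqP; split=> y.
  move=> [Oy yD]; have /orderP[a [b ey]] := Oy.
  have /orderP[a' [b' e]] : O (y * x) by apply/yD/Zadjoin_gen.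
  have : (b * f%:Z * N)%:~R + (a + b * f%:Z * T)%:~R * x
       = a'%:~R + (b' * f%:Z)%:~R * x :> algC.
    rewrite [in RHS]rmorphM /= -pmulrn -[in RHS]mulrA -e ey.
    transitivity (a%:~R * x + b%:~R * f%:R * x ^+ 2); last by ring.
    by rewrite x2 !rmorphD !rmorphM /= -!pmulrn; ring.
  move=> /coord_inj[_ eaf].
  exists ((b' - b * T)%:~R + b%:~R * x).
    by apply/(Zadjoin_quadraticP x2); exists (b' - b * T), b.
  have -> : y = (b' * f%:Z - b * f%:Z * T)%:~R + b%:~R * (f%:R * x).
    by rewrite ey -eaf addrK.
  by rewrite !rmorphB !rmorphM /= -!pmulrn; ring.
have fDO : principal D f%:R `<=` O.
  move=> _ [z /(Zadjoin_quadraticP x2)[a [b ->]] <-]; apply/orderP.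
  by exists (a * f%:Z), b; rewrite rmorphM /= -pmulrn; ring.
move=> fDy; split; first exact: fDO.
move=> z Dz; apply: fDO; case: fDy => w Dw <-; exists (w * z); last exact: mulrA.
by have [_ _ _ DM] := subring_Zadjoin x; apply: DM.
Qed.

(** Modulo F = f D every element of O is congruent to an integer: O / F is
    the prime field with f elements. *)
Lemma conductor_maximal : maximal_ideal O F.
Proof.
have sD := subring_Zadjoin x; have sO := subring_Zadjoin (f%:R * x).
have Dint := Zadjoin_int x; have Oint := Zadjoin_int (f%:R * x).
have Ff : F f%:R.
  by rewrite conductorE; exists 1; rewrite ?mulr1 //; apply: (Dint 1).
have [fDD fD0 fDA fDM] : ideal D (principal D f%:R).
  by apply: principal_ideal => //; rewrite pmulrn; apply: Dint.
have idF : ideal O F.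
  split; first by move=> y [].
  - by rewrite conductorE.
  - by rewrite conductorE.
  - by rewrite conductorE => r u /order_sub; apply: fDM.
split=> //.
  rewrite conductorE => -[y /(Zadjoin_quadraticP x2)[a [b ->]]] e.
  have : (f%:Z * a)%:~R + (f%:Z * b)%:~R * x = 1%:~R + 0%:~R * x.
    by rewrite mul0r addr0 -[RHS]e !rmorphM /= -!pmulrn; ring.
  move=> /coord_inj[efa _]; have : (f%:Z %| 1%R)%Z by rewrite -efa dvdz_mulr.
  by rewrite dvdz1 /=; case: (f) f_pr => [|[]].
move=> v /orderP[a [b ->]] nFv; have [_ _ FA FM] := idF.
have Fb : F (b%:~R * (f%:R * x)).
  rewrite conductorE; exists (b%:~R * x); last by rewrite mulrCA.
  by have [_ _ _ DM] := sD; apply: DM => //; apply: Zadjoin_gen.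
have [|u Fau] := ideal_int_inv f_pr sO Oint idF Ff (a := a).
  by move=> Fa; apply: nFv; apply: FA.
exists u%:~R; first exact: Oint.
have -> : 1 - (a%:~R + b%:~R * (f%:R * x)) * u%:~R
        = 1 - a%:~R * u%:~R - b%:~R * (f%:R * x) * u%:~R by ring.
by apply: (idealB sO idF) => //; apply: (idealMr idF) => //; apply: Oint.
Qed.

End Order.

(** * The generator omega of the maximal order *)

Lemma omega_quadratic (d : int) :
  exists T N : int, omega d ^+ 2 = T%:~R * omega d + N%:~R.
Proof.
rewrite /omega; case: eqP => [d1|_]; last first.
  by exists 0, d; rewrite sqrtCK mul0r add0r.
exists 1, (d %/ 4)%Z; set s := sqrtC _.
have s2 : s ^+ 2 = (d %/ 4)%Z%:~R * 4 + 1.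
  by rewrite sqrtCK {1}(divz_eq d 4) d1 rmorphD rmorphM.
transitivity ((1 + s *+ 2 + s ^+ 2) / 4); first by field.
by rewrite s2; field.
Qed.

(** A relation with b <> 0 would give a^2 = b^2 d, so that b divides a and d is
    the square of an integer; being square-free, d would be 1. *)
Lemma sqrt_square_free_free (d a b : int) : square_free d -> d != 1 ->
  a%:~R + b%:~R * sqrtC d%:~R = 0 :> algC -> a = 0 /\ b = 0.
Proof.
move=> sfd d1 e.
have e2 : a ^+ 2 = b ^+ 2 * d.
  apply: (@intr_inj algC); rewrite !rmorphM /= -!expr2 -[d%:~R]sqrtCK -exprMn.
  by apply/eqP; rewrite eqf_sqr; apply/orP; right; rewrite -addr_eq0 e.
have [b0|b0] := eqVneq b 0.
  by split=> //; move: e2; rewrite b0 expr0n mul0r => /eqP; rewrite expf_eq0 => /eqP.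
have /dvdzP[q ea] : (b %| a)%Z.
  have : (b ^+ 2 %| a ^+ 2)%Z by rewrite e2 dvdz_mulr.
  by rewrite !dvdzE !abszX dvdn_pexp2r.
have eq2 : q ^+ 2 = d.
  by apply: (mulfI (expf_neq0 2 b0)); rewrite -e2 ea exprMn mulrC.
have : q \is a GRing.unit by apply: sfd; rewrite eq2.
by case/orP => /eqP eq; move: d1; rewrite -eq2 eq.
Qed.

Lemma omega_free (d a b : int) : square_free d -> d != 1 ->
  a%:~R + b%:~R * omega d = 0 -> a = 0 /\ b = 0.
Proof.
move=> sfd d1; rewrite /omega; case: ifP => _; last exact: sqrt_square_free_free.
move=> e; have [|] := @sqrt_square_free_free d (a *+ 2 + b) b sfd d1.
  apply: (mulIf (_ : 2^-1 != 0 :> algC)); first by rewrite invr_eq0 pnatr_eq0.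
  by rewrite mul0r -[RHS]e rmorphD rmorphMn /=; field.
by move=> + b0; rewrite b0 addr0 => /eqP; rewrite mulrn_eq0 => /eqP.
Qed.

(** * Basic elements between P^5 and P^3 *)

Theorem proposition4p10 (d : int) (f : nat) (P : set algC) :
  square_free d -> d != 1 -> prime f ->
  let D := max_order d in
  let O := order_of_index d f in
  let F := conductor O D in
  prime_ideal D P ->
  principal D f%:R = idealX D P 2 ->
  ((exists t : algC, [/\ basic_element O F t,
                         idealX D P 5 `<` principal O t
                       & principal O t `<` idealX D P 3])
     <-> is_principal D P)
  /\
  (forall beta : algC, D beta -> P = principal D beta ->
     forall t : algC, basic_element O F t ->
       idealX D P 5 `<` principal O t ->
       principal O t `<` idealX D P 3 ->
       exists2 w, units D w & t = f%:R * beta * w).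
Proof.
move=> sfd d1 f_pr D O F primeP eP2.
have [T [N omega2]] := omega_quadratic d.
have omegaF a b := @omega_free d a b sfd d1.
have sD : subring D := subring_Zadjoin _.
have sO : subring O := subring_Zadjoin _.
have eF : F = principal D f%:R := conductorE omega2 omegaF f.
have maxF : maximal_ideal O F := conductor_maximal omega2 omegaF f_pr.
have f0 : f%:R != 0 :> algC by rewrite pnatr_eq0 -lt0n prime_gt0.
have [idP nP1 _] := primeP.
have idF : ideal D F.
  by rewrite eF; apply: principal_ideal; rewrite // pmulrn; apply: Zadjoin_int.
have PP : idealM P P = principal D f%:R by rewrite eP2 /idealX /= (idealM1 sD idP).
have Pf : P f%:R := square_root_mem sD idP PP.
have maxP : maximal_ideal D P := quadratic_maximal omega2 f_pr primeP Pf.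
have eF2 : idealX O F 2 = principal (principal D f%:R) f%:R.
  have [idOF _ _] := maxF.
  by rewrite /idealX /= (idealM1 sO idOF) {2}eF idealM_scale (idealM1 sD idF) eF.
have eP3 := idealX3 sD idP PP; have eP5 := idealX5 sD idP PP.
have OD : O `<=` D := order_sub omega2 (f := f).
have O1 : O 1 by case: sO.
have D1 : D 1 by case: sD.
have gen_neq0 beta : P = principal D beta -> beta != 0.
  move=> eP; apply/eqP => b0; have := Pf; rewrite eP b0 => -[y _ /esym/eqP].
  by rewrite mul0r (negbTE f0).
have main t : basic_element O F t -> idealX D P 5 `<` principal O t ->
    principal O t `<` idealX D P 3 ->
    exists s, [/\ D s, t = f%:R * s & P = principal D s].
  rewrite eP3 eP5 => -[Ot [_ nF2]] [P5t _] [tP3 _].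
  have [s Ps es] : principal P f%:R t by apply: tP3; exists 1; rewrite ?mulr1.
  exists s; split=> //; first by have [PD _ _ _] := idP; apply: PD.
  apply: (square_root_principal sD idP PP maxP f0 Ps) => [[y Dy ey]|_ [p Pp <-]].
    apply: nF2 => _ [z Oz <-]; rewrite eF2 -es -ey.
    exists (f%:R * (y * z)); last by rewrite !mulrA.
    by exists (y * z) => //; have [_ _ _ DM] := sD; apply: DM => //; apply: OD.
  have [z Oz ez] : principal O t (f%:R * (f%:R * p)).
    by apply: P5t; exists (f%:R * p) => //; exists p.
  by exists z; [apply: OD | apply: (mulfI f0); rewrite -ez -es mulrA].
split; last first.
  move=> beta Dbeta eP t bt P5t tP3; have [s [Ds -> ePs]] := main t bt P5t tP3.
  have beta0 := gen_neq0 beta eP.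
  have [|w Dw ->] := principal_eq_associate sD beta0 (y := s); first by rewrite -eP.
  by exists w; rewrite // mulrA.
split=> [[t [bt P5t tP3]]|[beta Dbeta eP]].
  by have [s [Ds _ ePs]] := main t bt P5t tP3; exists s.
have beta0 := gen_neq0 beta eP.
have nFbeta := square_root_generator_notin idP PP nP1 beta0 eP.
have PD : P `<=` D by case: idP.
have [[FO _ _ _] _ _] := maxF; have [_ _ _ DM] := sD.
have fO y : D y -> O (f%:R * y) by move=> Dy; apply: FO; rewrite eF; exists y.
have idtO : ideal O (principal O (f%:R * beta)).
  by apply: principal_ideal => //; apply: fO.
exists (f%:R * beta); split; last 2 first.
- rewrite eP5; split=> [_ [_ [p Pp <-] <-]|/(_ (f%:R * beta))].
    move: Pp; rewrite eP => -[z Dz <-].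
    by exists (f%:R * z); [apply: fO | ring].
  case; first by exists 1; rewrite ?mulr1.
  move=> _ [p Pp <-] /(mulfI f0) e; apply: nFbeta; exists p => //; exact: PD.
- rewrite eP3; split=> [_ [z Oz <-]|/(_ (f%:R * (beta * omega d)))].
    exists (beta * z); last by rewrite mulrA.
    by rewrite eP; exists z => //; apply: OD.
  case; first (exists (beta * omega d) => //; rewrite eP).
    by exists (omega d) => //; apply: Zadjoin_gen.
  move=> z Oz; rewrite mulrA => /(mulfI (mulf_neq0 f0 beta0)) ez.
  by apply: (generator_notin_order omega2 omegaF f_pr); move: Oz; rewrite ez.
split; first exact: fO.
split.
  apply: primary_to_maximal => //.
    move=> _ [z Oz <-]; rewrite eF; exists (beta * z); last by rewrite mulrA.
    by apply: DM => //; apply: OD.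
  (* P P = f D gives f = beta q, so (f y)^3 = f beta (f q y^3), with f D <= O *)
  exists 3%N; rewrite eF => _ [y Dy <-].
  have [q Dq eq] : principal D beta f%:R by rewrite -eP.
  exists (f%:R * (q * (y * (y * y)))).
    by apply: fO; do !apply: (DM) => //.
  transitivity (f%:R ^+ 2 * (beta * q) * y ^+ 3); first by ring.
  by rewrite eq; ring.
rewrite eF2 => /(_ (f%:R * beta)); case; first by exists 1; rewrite ?mulr1.
by move=> _ [y Dy <-] /(mulfI f0) e; apply: nFbeta; exists y.
Qed.
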